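(* Let $T:\mathbb{R}^n\rightrightarrows\mathbb{R}^n$ be a set-valued operator, $P,\Lambda,V\in\mathbb{R}^{n\times n}$ symmetric matrices ($V$ possibly indefinite), $\mathcal{U}\subseteq\mathbb{R}^n\times\mathbb{R}^n$, and $\mathcal{S}^\star\subseteq\mathrm{zer}\,T$ a nonempty convex set, such that: (a) $T$ has $V$-oblique weak Minty solutions at $\mathcal{S}^\star$ on $\mathcal{U}$; (b) $T$ is outer semicontinuous on $\mathcal{U}$; (c) $P\succ0$, $\Lambda\succ0$, $\Lambda P=P\Lambda$ and $\Lambda\prec2(\mathrm{I}+P^{1/2}VP^{1/2})$; (d) there is $\varepsilon>0$ such that for every $z\in\mathcal{W}:=\{z\in\mathbb{R}^n:\mathrm{dist}_{P\Lambda^{-1}}(z,\mathcal{S}^\star)\le\varepsilon\}$ there exists $\bar z$ with $(\bar z,P(z-\bar z))\in\mathrm{gph}\,T\cap\mathcal{U}$. Let $\bar\alpha:=\lambda_{\min}\bigl((\mathrm{I}+P^{1/2}VP^{1/2})\Lambda^{-1}\bigr)$, which satisfies $\bar\alpha>\tfrac12$. Let $z^0\in\mathcal{W}$ and let $(z^k,\bar z^k)_{k\in\mathbb{N}}$ be any sequence generated by the rule: find $\bar z^k$ such that $(\bar z^k,P(z^k-\bar z^k))\in\mathrm{gph}\,T\cap\mathcal{U}$, and set $z^{k+1}=z^k+\Lambda(\bar z^k-z^k)$. Then either a point $\bar z^k\in\mathcal{W}\cap\mathrm{zer}\,T$ is reached in a finite number of iterations, or the following hold. (i) $z^k\in\mathcal{W}$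 for all $k\in\mathbb{N}$, since the sequence $(\mathrm{dist}_{P\Lambda^{-1}}(z^k,\mathcal{S}^\star))_{k\in\mathbb{N}}$ is nonincreasing. (ii) The sequences $(\mathrm{dist}^2_{P^{-1}\Lambda}(0,T(\bar z^k)))_{k}$ and $(\|z^k-\bar z^k\|^2_{P\Lambda})_k$ converge to zero, and for every $N\in\mathbb{N}$ $$\min_{k=0,\dots,N}\mathrm{dist}^2_{P^{-1}\Lambda}(0,T(\bar z^k))\le\min_{k=0,\dots,N}\|z^k-\bar z^k\|^2_{P\Lambda}\le\frac{\mathrm{dist}^2_{P\Lambda^{-1}}(z^0,\mathcal{S}^\star)}{(N+1)(2\bar\alpha-1)}.$$ Additionally, if $T$ is $V$-comonotone on $\mathcal{U}$, then $(\|z^k-\bar z^k\|_{P\Lambda})_k$ is nonincreasing and for every $N\in\mathbb{N}$ $$\mathrm{dist}^2_{P^{-1}\Lambda}(0,T(\bar z^N))\le\|z^N-\bar z^N\|^2_{P\Lambda}\le\frac{\mathrm{dist}^2_{P\Lambda^{-1}}(z^0,\mathcal{S}^\star)}{(N+1)(2\bar\alpha-1)}.$$ (iii) The sequences $(z^k)_k$ and $(\bar z^k)_k$ are bounded and their limit points belong to $\mathcal{W}\cap\mathrm{zer}\,T$. (iv) If $\mathcal{S}^\star=\mathcal{W}\cap\mathrm{zer}\,T$, then the sequences $(z^k)_k$ and $(\bar z^k)_k$ converge to some element of $\mathcal{W}\cap\mathrm{zer}\,T$.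
   Context: $\mathrm{gph}\,T=\{(x,y):y\in T(x)\}$ and $\mathrm{zer}\,T=\{x:0\in T(x)\}$. For symmetric positive definite $Q$, $\|x\|_Q=\sqrt{\langle x,Qx\rangle}$ and $\mathrm{dist}_Q(x,E)=\inf_{z\in E}\|x-z\|_Q$. $A\prec B$ means $B-A$ is positive definite; $\lambda_{\min}$ denotes the smallest eigenvalue. $T$ has $V$-oblique weak Minty solutions at a nonempty convex set $\mathcal{S}^\star\subseteq\mathrm{zer}\,T$ on $\mathcal{U}$ if $\langle v,\bar z-z^\star\rangle\ge\langle v,Vv\rangle$ for all $z^\star\in\mathcal{S}^\star$ and all $(\bar z,v)\in\mathrm{gph}\,T\cap\mathcal{U}$. $T$ is $V$-comonotone on $\mathcal{U}$ if $\langle x-x',y-y'\rangle\ge\langle y-y',V(y-y')\rangle$ for all $(x,y),(x',y')\in\mathrm{gph}\,T\cap\mathcal{U}$. $T$ is outer semicontinuous on $\mathcal{U}$ if, whenever $(x^k,y^k)\in\mathrm{gph}\,T\cap\mathcal{U}$ and $(x^k,y^k)\to(\bar x,\bar y)$, one has $\bar y\in T(\bar x)$. *)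

(* Defs.v *)
From HB Require Import structures.
From mathcomp Require Import all_boot all_order all_algebra.
From mathcomp Require Import all_classical all_reals all_analysis.
Set Implicit Arguments.
Unset Strict Implicit.
Unset Printing Implicit Defensive.
Import Order.TTheory GRing.Theory Num.Theory numFieldNormedType.Exports.
Local Open Scope classical_set_scope.
Local Open Scope ring_scope.

Definition dot (R : realType) (n : nat) (x y : 'cV[R]_n) : R :=
  \sum_(i < n) x i 0 * y i 0.

Definition posdef (R : realType) (n : nat) (A : 'M[R]_n) : Prop :=
  A^T = A /\ forall x : 'cV[R]_n, x != 0 -> 0 < dot x (A *m x).

Definition possemidef (R : realType) (n : nat) (A : 'M[R]_n) : Prop :=
  A^T = A /\ forall x : 'cV[R]_n, 0 <= dot x (A *m x).

(* The (unique) positive semidefinite square root of A when there is one,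
   that is, when A is itself positive semidefinite; 0 otherwise. *)
Definition mxsqrt (R : realType) (n : nat) (A : 'M[R]_n) : 'M[R]_n :=
  xget 0 [set S | possemidef S /\ S *m S = A].

(* A square matrix has finitely many eigenvalues, so the infimum is the
   smallest real eigenvalue as soon as there is one (and it is 0 otherwise). *)
Definition lambda_min (R : realType) (n : nat) (A : 'M[R]_n) : R :=
  inf [set a | eigenvalue A a].

Definition qnorm (R : realType) (n : nat) (Q : 'M[R]_n) (x : 'cV[R]_n) : R :=
  Num.sqrt (dot x (Q *m x)).

(* Real-valued, hence only meaningful for nonempty E: the infimum of the empty
   set is 0 here, not +oo. *)
Definition qdist (R : realType) (n : nat) (Q : 'M[R]_n) (x : 'cV[R]_n)
    (E : set 'cV[R]_n) : R :=
  inf [set qnorm Q (x - z) | z in E].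

Definition gph (R : realType) (n : nat) (T : 'cV[R]_n -> set 'cV[R]_n) :
    set ('cV[R]_n * 'cV[R]_n) :=
  [set xy | T xy.1 xy.2].

Definition zer (R : realType) (n : nat) (T : 'cV[R]_n -> set 'cV[R]_n) :
    set 'cV[R]_n :=
  [set x | T x 0].

Definition oblique_weak_minty (R : realType) (n : nat)
    (T : 'cV[R]_n -> set 'cV[R]_n) (V : 'M[R]_n) (S : set 'cV[R]_n)
    (U : set ('cV[R]_n * 'cV[R]_n)) : Prop :=
  forall zs zb v : 'cV[R]_n, S zs -> (gph T `&` U) (zb, v) ->
    dot v (V *m v) <= dot v (zb - zs).

Definition comonotone (R : realType) (n : nat)
    (T : 'cV[R]_n -> set 'cV[R]_n) (V : 'M[R]_n)
    (U : set ('cV[R]_n * 'cV[R]_n)) : Prop :=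
  forall x y x' y' : 'cV[R]_n,
    (gph T `&` U) (x, y) -> (gph T `&` U) (x', y') ->
    dot (y - y') (V *m (y - y')) <= dot (x - x') (y - y').

Definition outer_semicontinuous (R : realType) (n : nat)
    (T : 'cV[R]_n -> set 'cV[R]_n) (U : set ('cV[R]_n * 'cV[R]_n)) : Prop :=
  forall (x y : nat -> 'cV[R]_n) (xb yb : 'cV[R]_n),
    (forall k, (gph T `&` U) (x k, y k)) ->
    x k @[k --> \oo] --> xb -> y k @[k --> \oo] --> yb -> T xb yb.

(* min_{k = 0, ..., N} u k: the minimum in R has no neutral element, so the
   iteration starts at u 0, which is one of the terms. *)
Definition min_upto (R : realType) (u : nat -> R) (N : nat) : R :=
  \big[Num.min/u 0%N]_(k < N.+1) u k.

(* Main.v *)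
(* With r_k = z_k - zb_k, the oblique weak Minty inequality at a solution s and
   the Rayleigh bound <y, M y> >= alpha <y, Lam y> (applied to y = P^1/2 r_k) give
     |z_(k+1) - s|^2 + (2 alpha - 1) |r_k|^2 <= |z_k - s|^2,
   with |.| the P Lam^-1 norm for the iterates and the P Lam norm for r_k.  Hence
   the distances to S* decrease and the |r_k|^2 are summable, which gives (i), (ii)
   and r_k -> 0; the limit points are zeros by outer semicontinuity, and once one
   of them lies in S* the distance to it is nonincreasing and tends to 0 along a
   subsequence, hence tends to 0.  None of this is affected by some zb_k being a
   zero of T, so the second alternative always holds. *)

Require Import Defs.
From HB Require Import structures.
From mathcomp Require Import all_boot all_order all_algebra.
From mathcomp Require Import all_classical all_reals all_analysis.
From mathcomp Require Import ring lra.
Set Implicit Arguments.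
Unset Strict Implicit.
Unset Printing Implicit Defensive.
Import Order.TTheory GRing.Theory Num.Theory numFieldNormedType.Exports.
Local Open Scope classical_set_scope.
Local Open Scope ring_scope.

(** * The inner product and definite matrices *)

Section Dot.
Variables (R : realType) (n : nat).
Implicit Types (x y z : 'cV[R]_n) (A B : 'M[R]_n).

Lemma dotE x y : dot x y = (x^T *m y) 0 0.
Proof. by rewrite mxE; apply: eq_bigr => i _; rewrite mxE. Qed.

Lemma dotC x y : dot x y = dot y x.
Proof. by apply: eq_bigr => i _; rewrite mulrC. Qed.

Lemma dotDr x y z : dot x (y + z) = dot x y + dot x z.
Proof. by rewrite !dotE mulmxDr mxE. Qed.

Lemma dotZr a x y : dot x (a *: y) = a * dot x y.
Proof. by rewrite !dotE -scalemxAr mxE. Qed.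

Lemma dotNr x y : dot x (- y) = - dot x y.
Proof. by rewrite -scaleN1r dotZr mulN1r. Qed.

Lemma dotBr x y z : dot x (y - z) = dot x y - dot x z.
Proof. by rewrite dotDr dotNr. Qed.

Lemma dotDl x y z : dot (x + y) z = dot x z + dot y z.
Proof. by rewrite !(dotC _ z) dotDr. Qed.

Lemma dotZl a x y : dot (a *: x) y = a * dot x y.
Proof. by rewrite !(dotC _ y) dotZr. Qed.

Lemma dotNl x y : dot (- x) y = - dot x y.
Proof. by rewrite !(dotC _ y) dotNr. Qed.

Lemma dotBl x y z : dot (x - y) z = dot x z - dot y z.
Proof. by rewrite dotDl dotNl. Qed.

Lemma dot0r x : dot x 0 = 0.
Proof. by rewrite -(scale0r 0) dotZr mul0r. Qed.

Lemma dot_adj A x y : dot (A *m x) y = dot x (A^T *m y).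
Proof. by rewrite !dotE trmx_mul mulmxA. Qed.

Lemma dot_symm A x y : A^T = A -> dot x (A *m y) = dot y (A *m x).
Proof. by move=> sA; rewrite dotC dot_adj sA. Qed.

Lemma dot_ge0 x : 0 <= dot x x.
Proof. by apply: sumr_ge0 => i _; rewrite -expr2 sqr_ge0. Qed.

Lemma dot_eq0 x : dot x x = 0 -> x = 0.
Proof.
move=> /eqP; rewrite psumr_eq0 => [/allP x0|i _]; last by rewrite -expr2 sqr_ge0.
apply/colP => i; have := x0 i (mem_index_enum _).
by rewrite /= -expr2 sqrf_eq0 mxE => /eqP.
Qed.

Lemma dot_gt0 x : x != 0 -> 0 < dot x x.
Proof.
by move=> x0; rewrite lt_neqAle dot_ge0 andbT eq_sym; apply: contra_neq x0 => /dot_eq0.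
Qed.

Lemma posdef_psd A : posdef A -> possemidef A.
Proof.
move=> [sA A0]; split=> // x; have [->|x0] := eqVneq x 0; last by rewrite ltW ?A0.
by rewrite mulmx0 dot0r.
Qed.

(* The quadratic t |-> <x - t A x, A (x - t A x)> is nonnegative and vanishes at 0. *)
Lemma psd_kernel A x : possemidef A -> dot x (A *m x) = 0 -> A *m x = 0.
Proof.
move=> [sA A0] Ax0; apply: dot_eq0.
set w := A *m x; set a := dot w w; set b := dot w (A *m w).
have b0 : 0 <= b by exact: A0.
have b1 : 0 < b + 1 by lra.
have := A0 (x - (a / (b + 1)) *: w).
rewrite mulmxBr -scalemxAr dotBr !dotBl !dotZr !dotZl Ax0.
rewrite (dot_symm x w sA) -/w -/a -/b.
(* With [t = a / (b + 1)] the value [- 2 t a + t^2 b] of the form becomes [- t^2 (b + 2)], so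
   [t = 0]; dividing by [b + 1] covers the case [b = 0]. *)
set t := a / (b + 1); have -> : a = t * (b + 1) by rewrite /t divfK ?gt_eqF.
move=> h; have h2 : t ^+ 2 * (b + 2) <= 0 by move: h; nra.
have /eqP : t ^+ 2 = 0.
  by apply/eqP; rewrite eq_le sqr_ge0 andbT; nra.
by rewrite sqrf_eq0 => /eqP ->; rewrite mul0r.
Qed.

(** By symmetry of [A], a row of its left kernel, transposed, is a vector killed by [A]; at a
    nonzero one the form would vanish. *)
Lemma posdef_unitmx A : posdef A -> A \in unitmx.
Proof.
move=> [sA A0]; rewrite -row_free_unit -kermx_eq0; apply/eqP/row_matrixP => i.
rewrite row0; apply: trmx_inj; rewrite trmx0; apply/eqP/negPn/negP => /A0.
have : row i (kermx A) *m A = 0 by apply/sub_kermxP; exact: row_sub.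
move=> /(congr1 trmx); rewrite trmx_mul sA trmx0 => ->.
by rewrite dot0r ltxx.
Qed.

End Dot.

Lemma posdef1 (R : realType) (n : nat) : posdef (1%:M : 'M[R]_n).
Proof. by split=> [|x x0]; rewrite ?trmx1// mul1mx dot_gt0. Qed.

(** * Topology of column vectors and the Rayleigh quotient *)

Lemma trmx_continuous (R : realType) (m n : nat) :
  continuous (trmx : 'M[R]_(m, n) -> 'M[R]_(n, m)).
Proof.
move=> x B /= /nbhs_ballP[e e0 eB]; apply/nbhs_ballP; exists e => // y [_ xy].
by apply: eB; split=> // i j; rewrite !mxE; exact: xy.
Qed.

Lemma le_coord_norm (R : realType) (m n : nat) (x : 'M[R]_(m, n)) i j :
  `|x i j| <= `|x|.
Proof.
rewrite [leRHS]/Num.norm/= mx_normrE.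
exact: (le_bigmax _ (fun ij => `|x ij.1 ij.2|) (i, j)).
Qed.

Lemma norm_le_coord (R : realType) (m n : nat) (x : 'M[R]_(m, n)) c :
  0 <= c -> (forall i j, `|x i j| <= c) -> `|x| <= c.
Proof.
move=> c0 xc; rewrite [leLHS]/Num.norm/= mx_normrE.
by apply/bigmax_leP; split=> // -[i j] _; exact: xc.
Qed.

Lemma trmx_norm (R : realType) (m n : nat) (x : 'M[R]_(m, n)) : `|x^T| = `|x|.
Proof.
have le_tr p q (y : 'M[R]_(p, q)) : `|y^T| <= `|y|.
  by apply: norm_le_coord => // i j; rewrite mxE le_coord_norm.
by apply/eqP; rewrite eq_le le_tr -{1}[x]trmxK le_tr.
Qed.

(** Carried over from row vectors by transposition, which is continuous and preserves the norm. *)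
Lemma cV_bounded_closed_compact (R : realType) n (A : set 'cV[R]_n) :
  bounded_set A -> closed A -> compact A.
Proof.
move=> bA cA.
have -> : A = trmx @` (trmx @^-1` A : set 'rV[R]_n).
  by apply/seteqP; split=> [x Ax|_ [x Ax <-]//]; exists x^T; rewrite /= trmxK.
apply: continuous_compact; first exact/continuous_subspaceT/trmx_continuous.
apply: bounded_closed_compact.
  case: bA => M [Mr AM]; exists M; split=> // y My x /(AM _ My) /=.
  by rewrite trmx_norm.
by apply: preimage_closed cA => x _; exact: trmx_continuous.
Qed.

Lemma cvg_coord (R : realType) (m n : nat) (X : Type) (F : set_system X)
    {FF : Filter F} (f : X -> 'M[R]_(m, n)) (x : 'M[R]_(m, n)) :
  f @ F --> x <-> forall i j, f t i j @[t --> F] --> x i j.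
Proof.
split=> [fx i j|fx].
  exact: (cvg_comp _ _ fx (@coord_continuous _ _ _ i j x)).
apply/cvg_ballP => e e0.
have : \forall t \near F, forall i j, ball (x i j) e (f t i j).
  by apply: filter_forall => i; apply: filter_forall => j; exact/cvg_ball.
by apply: filterS => t xt; split.
Qed.

Lemma cvg_sum_ord (R : realType) (n : nat) (X : Type) (F : set_system X)
    {FF : Filter F} (f : 'I_n -> X -> R) (l : 'I_n -> R) :
  (forall i, f i t @[t --> F] --> l i) ->
  \sum_(i < n) f i t @[t --> F] --> \sum_(i < n) l i.
Proof. by move=> fl; apply: cvg_big => [|i _]; [exact: add_continuous|]. Qed.

Lemma cvg_mulmx (R : realType) (m n p : nat) (X : Type) (F : set_system X)
    {FF : Filter F} (f : X -> 'M[R]_(m, n)) (g : X -> 'M[R]_(n, p))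
    (x : 'M[R]_(m, n)) (y : 'M[R]_(n, p)) :
  f @ F --> x -> g @ F --> y -> f t *m g t @[t --> F] --> x *m y.
Proof.
move=> /cvg_coord fx /cvg_coord gy; apply/cvg_coord => i j.
under eq_fun do rewrite mxE.
by rewrite mxE; apply: cvg_sum_ord => k; apply: cvgM.
Qed.

Lemma cvg_dot (R : realType) (n : nat) (X : Type) (F : set_system X)
    {FF : Filter F} (f g : X -> 'cV[R]_n) (x y : 'cV[R]_n) :
  f @ F --> x -> g @ F --> y -> dot (f t) (g t) @[t --> F] --> dot x y.
Proof.
move=> /cvg_coord fx /cvg_coord gy.
by apply: cvg_sum_ord => i; apply: cvgM.
Qed.

Lemma cvg_quad (R : realType) (n : nat) (A : 'M[R]_n) (X : Type)
    (F : set_system X) {FF : Filter F} (f : X -> 'cV[R]_n) (x : 'cV[R]_n) :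
  f @ F --> x -> dot (f t) (A *m f t) @[t --> F] --> dot x (A *m x).
Proof.
by move=> fx; apply: cvg_dot => //; apply: cvg_mulmx => //; exact: cvg_cst.
Qed.

Lemma quad_continuous (R : realType) (n : nat) (A : 'M[R]_n) :
  continuous (fun x : 'cV[R]_n => dot x (A *m x)).
Proof. by move=> x; exact: (@cvg_quad _ _ A _ (nbhs x) _ id x). Qed.

(* At a minimizer x of <x, A x> / <x, B x>, of value m, the form of A - m B is
   nonnegative and vanishes, so that x is in its kernel. *)
Lemma rayleigh (R : realType) (n : nat) (A B : 'M[R]_n) :
  (0 < n)%N -> A^T = A -> posdef B ->
  exists (m : R) (x : 'cV[R]_n), [/\ x != 0, A *m x = m *: (B *m x) &
    forall y : 'cV[R]_n, m * dot y (B *m y) <= dot y (A *m y)].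
Proof.
move=> n0 sA [sB B0].
(* The norm is the largest absolute value of an entry, so [K] is the boundary of a cube; the
   constant vector 1 lies on it because [0 < n]. *)
pose K := [set x : 'cV[R]_n | `|x| = 1].
have K0 x : K x -> x != 0.
  rewrite /K/= => x1; apply/eqP => x0.
  by move/eqP: x1; rewrite x0 normr0 eq_sym oner_eq0.
have cK : compact K.
  apply: cV_bounded_closed_compact.
    by exists 1; split=> // M M1 x /= ->; rewrite ltW.
  have -> : K = (Num.norm : 'cV[R]_n -> R) @^-1` [set 1] by [].
  by apply: preimage_closed (@closed_eq _ _) => x _; exact: norm_continuous.
have Kn : K !=set0.
  exists (const_mx 1); apply/eqP; rewrite eq_le norm_le_coord//=.
    have := le_coord_norm (const_mx 1 : 'cV[R]_n) (Ordinal n0) 0.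
    by rewrite mxE normr1.
  by move=> i j; rewrite mxE normr1.
pose q (x : 'cV[R]_n) := dot x (A *m x) / dot x (B *m x).
have [|x /set_mem Kx xmin] := compact_EVT_min Kn cK (f := q).
  apply: continuous_in_subspaceT => x /set_mem/K0 x0.
  apply: (cvgM (@quad_continuous _ _ A x)).
  by apply: (cvgV _ (@quad_continuous _ _ B x)); rewrite gt_eqF ?B0.
have x0 := K0 _ Kx.
(* The quotient [q] is invariant under nonzero scaling, so its minimum over [K] is its minimum over
   all nonzero vectors. *)
have min y : q x * dot y (B *m y) <= dot y (A *m y).
  have [->|y0] := eqVneq y 0; first by rewrite !mulmx0 !dot0r mulr0.
  have ny : 0 < `|y| by rewrite normr_gt0.
  have : K (`|y|^-1 *: y).
    by rewrite /K/= mx_normZ normfV normr_id mulVf ?gt_eqF.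
  move=> /mem_set/xmin; rewrite /q -!scalemxAr !dotZr !dotZl.
  rewrite -!mulf_div !mulfV ?gt_eqF ?invr_gt0// !mul1r.
  by rewrite ler_pdivlMr ?B0.
exists (q x), x; split=> //; apply/eqP; rewrite -subr_eq0 scalemxAl -mulmxBl.
apply/eqP/psd_kernel.
  split=> [|y]; first by rewrite linearB/= linearZ/= sA sB.
  by rewrite mulmxBl dotBr -scalemxAl dotZr subr_ge0.
by rewrite mulmxBl dotBr -scalemxAl dotZr /q divfK ?subrr// gt_eqF ?B0.
Qed.

(** Transposing [v A B^-1 = a v] gives [A v^T = a B v^T]: the eigenvalues of [A B^-1] are the
    generalized eigenvalues of the pair [(A, B)], and the least of them is the minimal Rayleigh
    quotient. In particular the infimum is attained. *)
Lemma lambda_min_rayleigh (R : realType) (n : nat) (A B : 'M[R]_n)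
    (l := lambda_min (A *m invmx B)) :
  (0 < n)%N -> A^T = A -> posdef B ->
  exists x : 'cV[R]_n, [/\ x != 0, A *m x = l *: (B *m x) &
    forall y : 'cV[R]_n, l * dot y (B *m y) <= dot y (A *m y)].
Proof.
move=> n0 sA pB; have [m [x [x0 Ax min]]] := rayleigh n0 sA pB.
have uB := posdef_unitmx pB; have [sB B0] := pB.
suff -> : l = m by exists x.
have ev_m : eigenvalue (A *m invmx B) m.
  apply/eigenvalueP; exists x^T; last by rewrite trmx_eq0.
  rewrite mulmxA -[A]sA -trmx_mul Ax linearZ/= trmx_mul sB.
  by rewrite -scalemxAl mulmxK.
have lb_m : lbound [set a | eigenvalue (A *m invmx B) a] m.
  move=> a /eigenvalueP[v va v0].
  have Av : A *m v^T = a *: (B *m v^T).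
    apply: trmx_inj; rewrite linearZ/= !trmx_mul trmxK sA sB.
    by rewrite -[LHS](mulmxKV uB) -(mulmxA v) va scalemxAl.
  have /B0 w0 : v^T != 0 by rewrite trmx_eq0.
  by have := min v^T; rewrite Av dotZr ler_pM2r.
apply/eqP; rewrite eq_le; apply/andP; split.
  by apply: ge_inf => //; exists m.
by apply: lb_le_inf => //; exists m.
Qed.

(** * Square roots *)

Lemma psd_conj (R : realType) (m n : nat) (A : 'M[R]_n) (K : 'M[R]_(m, n)) :
  possemidef A -> possemidef (K *m A *m K^T).
Proof.
move=> [sA A0]; split; first by rewrite !trmx_mul trmxK sA mulmxA.
move=> x; have := A0 (K^T *m x).
by rewrite !dotE trmx_mul trmxK !mulmxA.
Qed.

(** The Rayleigh minimum [m] of [- A] makes [- m] the largest eigenvalue of [A]. Were it 0, the form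
    of [A] would vanish at every basis vector, and each column of [A] would be 0 by [psd_kernel]. *)
Lemma psd_eigenvector (R : realType) (n : nat) (A : 'M[R]_n) :
  possemidef A -> A != 0 ->
  exists (a : R) (x : 'cV[R]_n), [/\ 0 < a, dot x x = 1 & A *m x = a *: x].
Proof.
case: n A => [A _ /eqP[]|n A [sA A0] An0]; first by apply/matrixP => -[].
have sNA : (- A)^T = - A by rewrite linearN/= sA.
have [m [x [x0 Ax min]]] := rayleigh (ltn0Sn n) sNA (posdef1 R n.+1).
have x2 : 0 < dot x x by exact: dot_gt0.
pose s := Num.sqrt (dot x x); have s2 : s ^+ 2 = dot x x by rewrite sqr_sqrtr ?ltW.
have s0 : s != 0 by rewrite gt_eqF ?sqrtr_gt0.
have {}Ax : A *m x = (- m) *: x.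
  by rewrite scaleNr -[x in m *: x]mul1mx -Ax mulNmx opprK.
exists (- m), (s^-1 *: x); split; last 2 first.
- by rewrite dotZl dotZr -s2 mulrA -expr2 -exprMn mulVf ?expr1n.
- by rewrite -scalemxAr Ax !scalerA mulrC.
have : 0 <= - m.
  by rewrite -(pmulr_lge0 _ x2) -dotZr -Ax.
rewrite le_eqVlt => /predU1P[m0|//]; case/eqP: An0.
apply/matrixP => i j; have /colP/(_ i) : A *m delta_mx j 0 = 0 :> 'cV_n.+1.
  apply: psd_kernel => //; apply/eqP; rewrite eq_le A0 andbT.
  have := min (delta_mx j 0); rewrite mulNmx dotNr.
  by rewrite -(opprK m) -m0 oppr0 mul0r oppr_ge0.
by rewrite -colE !mxE.
Qed.

(* Splitting off an eigenvector, A = A' + a x x^T with A' x = 0, lowers the rank. *)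
Lemma psd_sqrt_exists (R : realType) (n : nat) (A : 'M[R]_n) :
  possemidef A -> exists2 S, possemidef S & S *m S = A.
Proof.
have [r] := ubnP (\rank A); elim: r A => // r IH A rA pA.
have [->|A0] := eqVneq A 0.
  exists 0; last by rewrite mul0mx.
  by split=> [|x]; rewrite ?trmx0 ?mul0mx ?dot0r.
have [a [x [a0 xx Ax]]] := psd_eigenvector pA A0.
have [sA Age0] := pA.
have {}xx : x^T *m x = 1%:M.
  by apply/matrixP => i j; rewrite !ord1 -dotE xx mxE.
pose X := x *m x^T; have sX : X^T = X by rewrite trmx_mul trmxK.
have xA : x^T *m A = a *: x^T by rewrite -[LHS]trmxK trmx_mul sA trmxK Ax linearZ.
have XX : X *m X = X by rewrite /X -mulmxA (mulmxA x^T) xx mul1mx.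
have XA : X *m A = a *: X by rewrite /X -mulmxA xA scalemxAr.
have AX : A *m X = a *: X by rewrite /X mulmxA Ax scalemxAl.
pose A' := A - a *: X.
have A'x : A' *m x = 0.
  by rewrite mulmxBl Ax -scalemxAl /X -mulmxA xx mulmx1 subrr.
have pA' : possemidef A'.
  have -> : A' = (1%:M - X) *m A *m (1%:M - X)^T.
    rewrite linearB/= trmx1 sX mulmxBl mul1mx XA mulmxBr mulmx1 mulmxBl AX.
    by rewrite -scalemxAl XX subrr subr0.
  exact: psd_conj.
(* The rows of [A'] are combinations of those of [A]; the converse would give [A x = 0], against
   [A x = a x] with [a > 0] and [x] nonzero. *)
have rA' : (\rank A' < r)%N.
  have AA' : A' = (1%:M - X) *m A by rewrite mulmxBl mul1mx XA.
  rewrite -ltnS; apply: leq_trans rA; rewrite ltnS; apply: rank_ltmx.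
  rewrite ltmxE {1}AA' submxMl; apply/negP => /submxP[B AB].
  have /eqP : A *m x = 0 by rewrite AB -mulmxA A'x mulmx0.
  rewrite Ax scaler_eq0 gt_eqF//= => /eqP x0; move: xx.
  by rewrite x0 mulmx0 => /matrixP/(_ 0 0)/eqP; rewrite !mxE eq_sym oner_eq0.
have [S [sS S0] SS] := IH _ rA' pA'.
have Sx : S *m x = 0.
  by apply: dot_eq0; rewrite dot_adj sS mulmxA SS A'x dot0r.
have SX : S *m X = 0 by rewrite mulmxA Sx mul0mx.
have XS : X *m S = 0 by apply: trmx_inj; rewrite trmx_mul sS sX SX trmx0.
(* As [S] kills [x], the products [S X] and [X S] vanish, and the square is [A' + a X]. *)
exists (S + Num.sqrt a *: X); last first.
  rewrite mulmxDl !mulmxDr SS -!scalemxAl -!scalemxAr SX XS XX !scaler0.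
  by rewrite addr0 add0r scalerA -expr2 sqr_sqrtr ?ltW// subrK.
split=> [|y]; first by rewrite linearD/= linearZ/= sS sX.
rewrite mulmxDl dotDr addr_ge0// -scalemxAl dotZr mulr_ge0 ?sqrtr_ge0//.
by rewrite -XX -mulmxA -{1}sX -dot_adj dot_ge0.
Qed.

(** Existence of a root rules out the default value 0 of [xget]. *)
Lemma mxsqrtP (R : realType) (n : nat) (A : 'M[R]_n) :
  possemidef A -> possemidef (mxsqrt A) /\ mxsqrt A *m mxsqrt A = A.
Proof.
move=> /psd_sqrt_exists[S pS SS].
by have /= := @xgetPex _ 0 [set S | possemidef S /\ S *m S = A]; apply; exists S.
Qed.

Lemma mxsqrt_posdef (R : realType) (n : nat) (A : 'M[R]_n) :
  posdef A -> posdef (mxsqrt A).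
Proof.
move=> pA; have [pS SS] := mxsqrtP (posdef_psd pA); split=> [|x x0]; first by case: pS.
rewrite lt_neqAle pS.2 andbT eq_sym; apply/eqP => /(psd_kernel pS) Sx.
by have := pA.2 _ x0; rewrite -SS -mulmxA Sx mulmx0 dot0r ltxx.
Qed.

(** Writes the trace as a sum of values of the form of [A], so that for positive definite [A] a zero
    trace forces every column of [K] to vanish. *)
Lemma mxtrace_conj (R : realType) (m n : nat) (A : 'M[R]_n) (K : 'M[R]_(n, m)) :
  \tr (K^T *m A *m K) = \sum_j dot (col j K) (A *m col j K).
Proof.
apply: eq_bigr => j _; rewrite dotE tr_col mulmxA -row_mul [in RHS]colE mulmxA.
by rewrite -row_mul -colE [in RHS]mxE [in RHS]mxE.
Qed.

(* The commutator K of sqrt A and B solves the Sylvester equation S K + K S = 0,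
   and then tr (K^T S K) + tr (K S K^T) = 0. *)
Lemma mxsqrt_comm (R : realType) (n : nat) (A B : 'M[R]_n) :
  posdef A -> B *m A = A *m B -> B *m mxsqrt A = mxsqrt A *m B.
Proof.
move=> pA AB; have [pS SS] := mxsqrtP (posdef_psd pA).
have [_ S0] := mxsqrt_posdef pA.
set S := mxsqrt A in pS SS S0 *; set K := S *m B - B *m S.
have SK : S *m K + K *m S = 0.
  rewrite mulmxBr mulmxBl !mulmxA SS -(mulmxA B) SS AB.
  by rewrite addrC addrA subrK subrr.
(* By cyclicity the sum is the trace of [K^T (S K + K S)]. The double transpose gives the second
   term the shape required by [mxtrace_conj]. *)
have : \tr (K^T *m S *m K) + \tr (K^T^T *m S *m K^T) = 0.
  rewrite trmxK [in X in _ + X]mxtrace_mulC -!mulmxA -raddfD.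
  by rewrite -mulmxDr SK mulmx0 raddf0.
rewrite !mxtrace_conj => /eqP; rewrite paddr_eq0; last 2 first.
- by apply: sumr_ge0 => j _; exact: pS.2.
- by apply: sumr_ge0 => j _; exact: pS.2.
rewrite psumr_eq0; last by move=> j _; exact: pS.2.
move=> /andP[/allP K0 _]; apply/esym/eqP; rewrite -subr_eq0; apply/eqP/matrixP => i j.
have /= /eqP cK := K0 j (mem_index_enum _).
have {}cK : col j K = 0.
  by apply/eqP/negPn/negP => /S0; rewrite cK ltxx.
by move/colP: cK => /(_ i); rewrite !mxE.
Qed.

(** * Norms and distances induced by a positive definite matrix *)

Section Qnorm.
Variables (R : realType) (n : nat) (Q : 'M[R]_n).
Hypothesis pQ : posdef Q.
Implicit Types (x y z : 'cV[R]_n) (E : set 'cV[R]_n).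

Lemma qnorm_ge0 (A : 'M[R]_n) x : 0 <= qnorm A x.
Proof. exact: sqrtr_ge0. Qed.

Lemma qnorm_sqr x : qnorm Q x ^+ 2 = dot x (Q *m x).
Proof. by rewrite sqr_sqrtr//; case: (posdef_psd pQ). Qed.

Lemma qnormN x : qnorm Q (- x) = qnorm Q x.
Proof. by rewrite /qnorm mulmxN dotNl dotNr opprK. Qed.

(** With [a = |x|] and [b = |y|], the form at [b x - a y] is [2 a b (a b - <x, Q y>)]; the cases
    [a = 0] and [b = 0] are trivial. *)
Lemma cauchy_schwarz x y : dot x (Q *m y) <= qnorm Q x * qnorm Q y.
Proof.
have qnorm0 z : qnorm Q z = 0 -> z = 0.
  move=> z0; apply/eqP/negPn/negP => /pQ.2.
  by rewrite -qnorm_sqr z0 expr0n ltxx.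
have [/qnorm0->|a0] := eqVneq (qnorm Q x) 0.
  by rewrite dotC dot0r mulr_ge0 ?qnorm_ge0.
have [/qnorm0->|b0] := eqVneq (qnorm Q y) 0.
  by rewrite mulmx0 dot0r mulr_ge0 ?qnorm_ge0.
have := (posdef_psd pQ).2 (qnorm Q y *: x - qnorm Q x *: y).
rewrite mulmxBr -!scalemxAr dotBr !dotBl !dotZl !dotZr (dot_symm y x pQ.1).
rewrite -!qnorm_sqr; set a := qnorm Q x in a0 *; set b := qnorm Q y in b0 *.
have ab0 : 0 < a * b by rewrite lt_neqAle eq_sym mulf_neq0//= mulr_ge0 ?qnorm_ge0.
move=> h; rewrite -(ler_pM2l ab0); move: h; lra.
Qed.

Lemma qnormD x y : qnorm Q (x + y) <= qnorm Q x + qnorm Q y.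
Proof.
rewrite -ler_sqr ?nnegrE ?addr_ge0 ?qnorm_ge0// qnorm_sqr mulmxDr dotDr !dotDl.
rewrite (dot_symm y x pQ.1) sqrrD !qnorm_sqr.
have := cauchy_schwarz x y; lra.
Qed.

Lemma qdist_ge0 (A : 'M[R]_n) x E : 0 <= qdist A x E.
Proof.
have [->|E0] := eqVneq E set0; first by rewrite /qdist image_set0 inf0.
apply: lb_le_inf => [|_ [z _ <-]]; last exact: qnorm_ge0.
by have /set0P[z Ez] := E0; exists (qnorm A (x - z)), z.
Qed.

Lemma qdist_le (A : 'M[R]_n) x E z : E z -> qdist A x E <= qnorm A (x - z).
Proof.
move=> Ez; apply: ge_inf; last by exists z.
by exists 0 => _ [y _ <-]; exact: qnorm_ge0.
Qed.

Lemma le_qdist (A : 'M[R]_n) x E c : E !=set0 ->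
  (forall z, E z -> c <= qnorm A (x - z)) -> c <= qdist A x E.
Proof.
move=> [z Ez] cE; apply: lb_le_inf => [|_ [y Ey <-]]; last exact: cE.
by exists (qnorm A (x - z)), z.
Qed.

(** Passes a bound valid at every point of [E] to the squared distance without choosing a nearest
    point. *)
Lemma le_qdist_sqr x E c : E !=set0 ->
  (forall z, E z -> c <= dot (x - z) (Q *m (x - z))) -> c <= qdist Q x E ^+ 2.
Proof.
move=> E0 cE; have [c0|/ltW c0] := leP 0 c; last exact: le_trans c0 (sqr_ge0 _).
rewrite -(sqr_sqrtr c0) ler_sqr ?nnegrE ?sqrtr_ge0 ?qdist_ge0//.
by apply: le_qdist => // z /cE; exact: ler_wsqrtr.
Qed.

Lemma qdist_triangle x y E : E !=set0 ->
  qdist Q x E <= qnorm Q (x - y) + qdist Q y E.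
Proof.
move=> E0; rewrite -lerBlDl; apply: le_qdist => // z Ez; rewrite lerBlDl.
apply: le_trans (qdist_le Q x Ez) _.
by apply: le_trans (qnormD _ _); rewrite subrKA.
Qed.

(** The constant is the least Rayleigh quotient of [Q] relative to the identity; the largest entry
    is at most the Euclidean norm. *)
Lemma posdef_coercive : (0 < n)%N ->
  exists2 c, 0 < c & forall x, c * `|x| ^+ 2 <= dot x (Q *m x).
Proof.
move=> n0.
have [m [x [x0 Qx min]]] := rayleigh n0 pQ.1 (posdef1 R n).
have m0 : 0 < m.
  by have := pQ.2 _ x0; rewrite Qx mul1mx dotZr pmulr_lgt0 ?dot_gt0.
exists m => // y; apply: le_trans (min y); rewrite mul1mx ler_pM2l//.
rewrite -[leRHS]sqr_sqrtr ?dot_ge0// ler_sqr ?nnegrE ?sqrtr_ge0//.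
apply: norm_le_coord; rewrite ?sqrtr_ge0// => i j; rewrite ord1 -sqrtr_sqr.
apply: ler_wsqrtr; rewrite /dot (bigD1 i)//= expr2 lerDl.
by apply: sumr_ge0 => k _; rewrite -expr2 sqr_ge0.
Qed.

Lemma qnorm_cvg0 (X : Type) (F : set_system X) {FF : Filter F}
    (f : X -> 'cV[R]_n) : (0 < n)%N ->
  dot (f t) (Q *m f t) @[t --> F] --> 0 -> f @ F --> (0 : 'cV[R]_n).
Proof.
move=> n0 f0; have [c c0 cQ] := posdef_coercive n0.
apply/cvgr0Pnorm_lt => e e0.
move/cvgr0Pnorm_lt: f0 => /(_ (c * e ^+ 2)); rewrite mulr_gt0 ?exprn_gt0// => /(_ isT).
apply: filterS => t ft; rewrite -ltr_sqr ?nnegrE ?(ltW e0)// -(ltr_pM2l c0).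
exact: le_lt_trans (le_trans (cQ _) (ler_norm _)) ft.
Qed.

Lemma qnorm_bounded (u : nat -> 'cV[R]_n) (s : 'cV[R]_n) C : (0 < n)%N ->
  (forall k, dot (u k - s) (Q *m (u k - s)) <= C) -> bounded_fun u.
Proof.
move=> n0 uC; have [c c0 cQ] := posdef_coercive n0.
exists (Num.sqrt (C / c) + `|s|); split; first exact: num_real.
move=> M /ltW lM k _; apply: le_trans lM.
rewrite -[u k](subrK s); apply: le_trans (ler_normD _ _) _; rewrite lerD2r.
rewrite -[leLHS]ger0_norm// -sqrtr_sqr; apply: ler_wsqrtr.
by rewrite ler_pdivlMr// mulrC; apply: le_trans (cQ _) (uC _).
Qed.

End Qnorm.

(** * Bounded sequences and their limit points *)

Lemma bounded_cluster (R : realType) (n : nat) (u : nat -> 'cV[R]_n) :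
  bounded_fun u -> exists x, cluster (u @ \oo) x.
Proof.
move=> [M [Mr uM]].
pose K := [set x : 'cV[R]_n | `|x| <= M + 1].
have cK : compact K.
  apply: cV_bounded_closed_compact.
    exists (M + 1); split=> [|N MN x /= Kx]; first exact: num_real.
    exact: le_trans Kx (ltW MN).
  have -> : K = (Num.norm : 'cV[R]_n -> R) @^-1` [set r | r <= M + 1] by [].
  by apply: preimage_closed (@closed_le _ _) => x _; exact: norm_continuous.
have [|x [_ ux]] := cK (u @ \oo) _; last by exists x.
by exists 0%N => // k _; apply: (uM (M + 1) _ k I); rewrite ltrDl.
Qed.

(** An index [phi k >= k] is chosen with [u (phi k)] within [1 / (k + 1)] of [x]; [phi] tends to
    infinity but may fail to be increasing. *)
Lemma cluster_subseq (R : realType) (n : nat) (u : nat -> 'cV[R]_n) x :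
  cluster (u @ \oo) x -> exists phi : nat -> nat,
  phi k @[k --> \oo] --> \oo /\ u (phi k) @[k --> \oo] --> x.
Proof.
move=> ux.
have /choice[phi hphi] : forall k, exists m, (k <= m)%N /\ `|x - u m| < k.+1%:R^-1.
  move=> k; have Fk : (u @ \oo) [set u m | m in [set m | (k <= m)%N]].
    by exists k => // m /= km; exists m.
  have k0 : 0 < k.+1%:R^-1 :> R by rewrite invr_gt0.
  have [_ [[m km <-] xm]] := ux _ _ Fk (nbhsx_ballx x _ k0).
  by exists m; split=> //; move: xm; rewrite -ball_normE.
exists phi; split.
  move=> A [N _ NA]; exists N => // k /= Nk; apply: NA => /=.
  exact: leq_trans Nk (hphi k).1.
apply/cvgrPdist_lt => e e0; near=> k.
apply: lt_trans (hphi k).2 _; near: k; exact: near_infty_natSinv_lt (PosNum e0).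
Unshelve. all: by end_near. Qed.

(** * One step of the iteration *)

Section Step.
Variables (R : realType) (n : nat) (P Lam V : 'M[R]_n).
Let D := mxsqrt P.
Let M := 1%:M + D *m V *m D.
Let alpha := lambda_min (M *m invmx Lam).
Let Q := P *m invmx Lam.
Let G := P *m Lam.
Hypotheses (n0 : (0 < n)%N) (V_sym : V^T = V).
Hypotheses (P_posdef : posdef P) (Lam_posdef : posdef Lam).
Hypothesis LP : Lam *m P = P *m Lam.

Let DD : D *m D = P.
Proof. exact: (mxsqrtP (posdef_psd P_posdef)).2. Qed.

Let D_sym : D^T = D.
Proof. by have [] := mxsqrt_posdef P_posdef. Qed.

Let LD : Lam *m D = D *m Lam.
Proof. exact: mxsqrt_comm. Qed.

Let M_sym : M^T = M.
Proof. by rewrite linearD/= trmx1 !trmx_mul D_sym V_sym mulmxA. Qed.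

Let Lam_unit : Lam \in unitmx.
Proof. exact: posdef_unitmx. Qed.

Let QL : Q *m Lam = P.
Proof. exact: mulmxKV. Qed.

(** Since [D] commutes with [Lam], [G = D Lam D]. *)
Let dotG x : dot x (G *m x) = dot (D *m x) (Lam *m (D *m x)).
Proof. by rewrite dot_adj D_sym !mulmxA -LD -(mulmxA Lam) DD LP. Qed.

Lemma mulmx_posdef : posdef G.
Proof.
split=> [|x x0]; first by rewrite trmx_mul Lam_posdef.1 P_posdef.1 LP.
rewrite dotG; apply: Lam_posdef.2; apply: contra_neq x0 => Dx.
by rewrite -[x](mulKmx (posdef_unitmx (mxsqrt_posdef P_posdef))) Dx mulmx0.
Qed.

(** Substituting [x = Lam y] turns [<x, Q x>] into [<y, G y>]. *)
Lemma mulmx_inv_posdef : posdef Q.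
Proof.
split=> [|x x0].
  rewrite trmx_mul trmx_inv Lam_posdef.1 P_posdef.1.
  by rewrite -[LHS](mulmxK Lam_unit) -(mulmxA _ P) -LP mulKmx.
rewrite -[x](mulKVmx Lam_unit); set y := invmx Lam *m x.
have y0 : y != 0.
  by apply: contra_neq x0 => y0; rewrite -[x](mulKVmx Lam_unit) -/y y0 mulmx0.
by rewrite (mulmxA Q) QL dot_adj Lam_posdef.1 (mulmxA Lam) LP mulmx_posdef.2.
Qed.

(** At an eigenvector with [M x = alpha Lam x], the form of [2 M - Lam] equals
    [(2 alpha - 1) <x, Lam x>]. *)
Lemma lambda_min_gt_half : posdef (2 *: M - Lam) -> 2^-1 < alpha.
Proof.
move=> [_ ML]; have [x [x0 Mx _]] := lambda_min_rayleigh n0 M_sym Lam_posdef.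
have := ML _ x0; rewrite mulmxBl -scalemxAl Mx dotBr !dotZr mulrA subr_gt0.
by rewrite -{1}[dot x _]mul1r ltr_pM2r ?Lam_posdef.2// -/alpha; lra.
Qed.

(** The Rayleigh bound at [D y]: the identity in [M] contributes [<y, P y>], and [D V D] contributes
    [<P y, V P y>]. *)
Lemma oblique_bound y :
  alpha * dot y (G *m y) <= dot (P *m y) (V *m (P *m y)) + dot y (P *m y).
Proof.
have [_ [_ _ /(_ (D *m y))]] := lambda_min_rayleigh n0 M_sym Lam_posdef.
rewrite -dotG -/alpha => /le_trans; apply.
rewrite mulmxDl mul1mx dotDr !(dot_adj D y) !D_sym !mulmxA DD addrC.
by rewrite -!mulmxA (mulmxA D D) DD !(dot_adj P) P_posdef.1 mulmxA.
Qed.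

(* The step is a Fejer contraction in the P Lam^-1 norm: with r = z - zb and w = z - s,
   |w - Lam r|^2 = |w|^2 - 2 <P r, w> + |r|^2, where |r| is the P Lam norm. *)
Lemma fejer_step z zb s (v := P *m (z - zb)) (z' := z + Lam *m (zb - z)) :
  dot v (V *m v) <= dot v (zb - s) ->
  dot (z' - s) (Q *m (z' - s)) + (2 * alpha - 1) * dot (z - zb) (G *m (z - zb))
  <= dot (z - s) (Q *m (z - s)).
Proof.
move=> vV; set r := z - zb; set w := z - s.
have -> : z' - s = w - Lam *m r by rewrite /z' /w /r -(opprB z zb) mulmxN addrAC.
have zbs : zb - s = w - r by rewrite /w /r opprB [RHS]addrC subrKA.
have {}vV : dot (P *m r) (V *m (P *m r)) <= dot (P *m r) (w - r).
  by rewrite -zbs.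
clearbody r w; have sQ := mulmx_inv_posdef.1.
have wr : dot (Lam *m r) (Q *m w) = dot w (P *m r).
  by rewrite (dot_symm _ _ sQ) mulmxA QL.
have rr : dot (Lam *m r) (P *m r) = dot r (G *m r).
  by rewrite dot_adj Lam_posdef.1 mulmxA LP.
rewrite (mulmxBr Q w) (mulmxA Q) QL dotBr !dotBl wr rr.
rewrite dotBr (dotC _ w) (dotC _ r) in vV.
(* The Minty inequality and [oblique_bound] add up to [alpha |r|^2 <= <w, P r>], which bounds the
   cross term [- 2 <w, P r>]. *)
have := oblique_bound r; move: vV; lra.
Qed.

(** Let [e] be the difference of the residuals [r] and [r']. Then [w = P e] and
    [zb - zb' = Lam r - e], so comonotonicity and [oblique_bound] give [alpha |e|^2 <= <r, G e>].
    Hence [|r'|^2 = |r|^2 - 2 <r, G e> + |e|^2] is at most [|r|^2 - (2 alpha - 1) |e|^2]. *)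
Lemma comonotone_step z zb zb' (z' := z + Lam *m (zb - z))
    (w := P *m (z - zb) - P *m (z' - zb')) : 2^-1 < alpha ->
  dot w (V *m w) <= dot (zb - zb') w ->
  dot (z' - zb') (G *m (z' - zb')) <= dot (z - zb) (G *m (z - zb)).
Proof.
move=> a2; set r := z - zb; set e := r - (z' - zb').
have -> : w = P *m e by rewrite /w -mulmxBr.
have -> : zb - zb' = Lam *m r - e.
  rewrite /e /r /z' -(opprB zb z) mulmxN; move: (Lam *m _) => u.
  by apply/colP => i; rewrite !mxE; ring.
have -> : z' - zb' = r - e by rewrite /e subKr.
clearbody r e; rewrite dotBl (dot_adj Lam) Lam_posdef.1 (mulmxA Lam P) LP -/G => h.
have sG := mulmx_posdef.1.
rewrite mulmxBr dotBr !dotBl (dot_symm e r sG).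
have ee : 0 <= dot e (G *m e) by exact: (posdef_psd mulmx_posdef).2.
have := oblique_bound e; move: h; nra.
Qed.

(** For [r = z_k - zb_k], the vector [P r] is an element of [T zb_k]; its norm therefore bounds the
    distance from 0 to [T zb_k]. *)
Lemma qnorm_residual (r : 'cV[R]_n) :
  qnorm (invmx P *m Lam) (P *m r) = qnorm G r.
Proof.
rewrite /qnorm dot_adj P_posdef.1 !mulmxA mulmxV ?posdef_unitmx// mul1mx.
by rewrite LP.
Qed.

End Step.

(** * Convergence *)

Lemma min_upto_le (R : realType) (u : nat -> R) (N k : nat) :
  (k <= N)%N -> min_upto u N <= u k.
Proof. by move=> kN; exact: (bigmin_le _ (Ordinal (kN : (k < N.+1)%N)) (u \o val)). Qed.

Lemma le_min_upto (R : realType) (u : nat -> R) (N : nat) c :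
  (forall k, (k <= N)%N -> c <= u k) -> c <= min_upto u N.
Proof.
by move=> cu; apply: le_bigmin => [|k _]; apply: cu => //; exact: (ltn_ord k).
Qed.

Lemma nonneg_bounded_series_cvg0 (R : realType) (u : nat -> R) C :
  (forall k, 0 <= u k) -> (forall N, \sum_(k < N) u k <= C) ->
  u k @[k --> \oo] --> 0.
Proof.
move=> u0 uC; apply: (@cvg_series_cvg_0 R R^o); apply: nondecreasing_is_cvgn.
  by apply/nondecreasing_seqP => k; rewrite seriesSr lerDl; exact: u0.
by exists C => _ [N _ <-]; rewrite seriesEord; exact: uC.
Qed.

Lemma qnorm_cvg (R : realType) (n : nat) (A : 'M[R]_n) (X : Type)
    (F : set_system X) {FF : Filter F} (f : X -> 'cV[R]_n) (x : 'cV[R]_n) :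
  f @ F --> x -> qnorm A (f t) @[t --> F] --> qnorm A x.
Proof.
by move=> /cvg_quad fx; apply: (cvg_comp _ _ (fx A)); exact: sqrt_continuous.
Qed.

Lemma nonincreasing_subseq_cvg0 (R : realType) (a : nat -> R) (phi : nat -> nat) :
  nonincreasing_seq a -> (forall k, 0 <= a k) ->
  a (phi k) @[k --> \oo] --> 0 -> a k @[k --> \oo] --> 0.
Proof.
move=> a_mono a0 /cvgr0Pnorm_lt aphi; apply/cvgr0Pnorm_lt => e e0.
have [N _ /(_ N (leqnn N)) /= aN] := aphi e e0.
exists (phi N) => // k /= Nk; rewrite ger0_norm//.
by apply: le_lt_trans aN; apply: le_trans (ler_norm _); exact: a_mono.
Qed.

Lemma bounded_funB (R : realType) (V : normedModType R) (X : Type) (f g : X -> V) :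
  bounded_fun f -> bounded_fun g -> bounded_fun (f \- g).
Proof.
move=> [M [Mr fM]] [N [Nr gN]]; exists (M + 1 + (N + 1)); split; first exact: num_real.
move=> C /ltW MNC t _; apply: le_trans MNC; apply: le_trans (ler_normB _ _) _.
by apply: lerD; [apply: (fM (M + 1))|apply: (gN (N + 1))]; rewrite ?ltrDl.
Qed.

Theorem theorem3p8 (R : realType) (n : nat) (n_gt0 : (0 < n)%N)
    (T : 'cV[R]_n -> set 'cV[R]_n) (P Lam V : 'M[R]_n)
    (U : set ('cV[R]_n * 'cV[R]_n)) (Sstar : set 'cV[R]_n) (eps : R)
    (W := [set z : 'cV[R]_n | qdist (P *m invmx Lam) z Sstar <= eps])
    (M := 1%:M + mxsqrt P *m V *m mxsqrt P)
    (alpha := lambda_min (M *m invmx Lam))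
    (P_sym : P^T = P) (Lam_sym : Lam^T = Lam) (V_sym : V^T = V)
    (S_neq0 : Sstar !=set0) (S_convex : convex_set Sstar)
    (S_zer : Sstar `<=` zer T)
    (T_minty : oblique_weak_minty T V Sstar U)
    (T_osc : outer_semicontinuous T U)
    (P_posdef : posdef P) (Lam_posdef : posdef Lam)
    (Lam_P_comm : Lam *m P = P *m Lam)
    (Lam_lt : posdef (2 *: M - Lam))
    (eps_gt0 : 0 < eps)
    (step_exists : forall z, W z ->
       exists zb, (gph T `&` U) (zb, P *m (z - zb))) :
  2^-1 < alpha /\
  forall z zb : nat -> 'cV[R]_n,
    W (z 0%N) ->
    (forall k, (gph T `&` U) (zb k, P *m (z k - zb k)) /\
               z k.+1 = z k + Lam *m (zb k - z k)) ->
    let rnorm k := qnorm (P *m Lam) (z k - zb k) in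
    let rdist k := qdist (invmx P *m Lam) 0 (T (zb k)) in
    let bound N := qdist (P *m invmx Lam) (z 0%N) Sstar ^+ 2
                   / (N.+1%:R * (2 * alpha - 1)) in
    (exists k, (W `&` zer T) (zb k)) \/
    [/\ (* (i) *)
        (forall k, W (z k)) /\
        nonincreasing_seq (fun k => qdist (P *m invmx Lam) (z k) Sstar),
        (* (ii) *)
        [/\ rdist k ^+ 2 @[k --> \oo] --> 0,
            rnorm k ^+ 2 @[k --> \oo] --> 0,
            forall N, min_upto (fun k => rdist k ^+ 2) N
                      <= min_upto (fun k => rnorm k ^+ 2) N <= bound N
          & comonotone T V U ->
            nonincreasing_seq rnorm /\
            forall N, rdist N ^+ 2 <= rnorm N ^+ 2 <= bound N],
        (* (iii) *)
        [/\ bounded_fun z, bounded_fun zb,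
            cluster (z k @[k --> \oo]) `<=` W `&` zer T
          & cluster (zb k @[k --> \oo]) `<=` W `&` zer T]
      & (* (iv) *)
        Sstar = W `&` zer T ->
        exists2 zlim, (W `&` zer T) zlim &
          z k @[k --> \oo] --> zlim /\ zb k @[k --> \oo] --> zlim].
Proof.
pose Q := P *m invmx Lam; pose G := P *m Lam.
have a2 : 2^-1 < alpha by exact: lambda_min_gt_half.
have pG : posdef G by exact: mulmx_posdef.
have pQ : posdef Q by exact: mulmx_inv_posdef.
split=> // z zb W0 step rnorm rdist bound; right.
have rE k : rnorm k ^+ 2 = dot (z k - zb k) (G *m (z k - zb k)).
  exact: qnorm_sqr.
have a0 : 0 < 2 * alpha - 1 by lra.
have fejer s k : Sstar s -> dot (z k.+1 - s) (Q *m (z k.+1 - s))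
    + (2 * alpha - 1) * rnorm k ^+ 2 <= dot (z k - s) (Q *m (z k - s)).
  move=> Ss; have [gk ->] := step k; rewrite rE.
  by apply: fejer_step => //; exact: T_minty.
have fejer_le s k : Sstar s ->
    dot (z k.+1 - s) (Q *m (z k.+1 - s)) <= dot (z k - s) (Q *m (z k - s)).
  move=> /fejer - /(_ k); apply: le_trans; rewrite lerDl.
  by rewrite mulr_ge0 ?sqr_ge0// ltW.
have dist_mono : nonincreasing_seq (fun k => qdist Q (z k) Sstar).
  apply/nonincreasing_seqP => k; apply: le_qdist => // s Ss.
  by apply: le_trans (qdist_le _ _ Ss) _; apply: ler_wsqrtr; exact: fejer_le.
have Wz k : W (z k) by exact: le_trans (dist_mono _ _ (leq0n k)) W0.
(* The inequality telescopes at a fixed [s], the last distance is dropped, and only then is the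
   infimum over [s] taken. *)
have sum_le N : (2 * alpha - 1) * \sum_(k < N) rnorm k ^+ 2
    <= qdist Q (z 0%N) Sstar ^+ 2.
  apply: le_qdist_sqr => // s Ss.
  suff : dot (z N - s) (Q *m (z N - s)) + (2 * alpha - 1) * \sum_(k < N) rnorm k ^+ 2
    <= dot (z 0%N - s) (Q *m (z 0%N - s)).
    apply: le_trans; rewrite lerDr; exact: (posdef_psd pQ).2.
  elim: N => [|N]; first by rewrite big_ord0 mulr0 addr0.
  by apply: le_trans; rewrite big_ord_recr/= mulrDr; have := fejer s N Ss; lra.
have rnorm0 : rnorm k ^+ 2 @[k --> \oo] --> 0.
  pose C := qdist Q (z 0%N) Sstar ^+ 2 / (2 * alpha - 1).
  apply: (@nonneg_bounded_series_cvg0 _ _ C).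
    by move=> k; exact: sqr_ge0.
  by move=> N; rewrite ler_pdivlMr// mulrC.
(* [N + 1] terms, each at least [c], sum to at least [(N + 1) c]. This serves both rates, with [c]
   the minimum or, under comonotonicity, the last residual. *)
have le_bound c N : (forall k, (k <= N)%N -> c <= rnorm k ^+ 2) -> c <= bound N.
  move=> cr; rewrite /bound ler_pdivlMr ?mulr_gt0//; apply: le_trans (sum_le N.+1).
  rewrite mulrA mulrC ler_pM2l// mulr_natr -[X in _ *+ X]card_ord -sumr_const.
  by apply: ler_sum => k _; apply: cr; exact: (ltn_ord k).
have rdist_le k : rdist k ^+ 2 <= rnorm k ^+ 2.
  rewrite ler_sqr ?nnegrE ?qnorm_ge0 ?qdist_ge0//.
  have [[Tk _] _] := step k; apply: le_trans (qdist_le _ _ Tk) _.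
  by rewrite sub0r qnormN qnorm_residual.
have r0 : z k - zb k @[k --> \oo] --> (0 : 'cV[R]_n).
  by apply: (qnorm_cvg0 pG) => //; under eq_fun do rewrite -rE.
have lim_pt (phi : nat -> nat) x : phi k @[k --> \oo] --> \oo ->
    z (phi k) @[k --> \oo] --> x -> (W `&` zer T) x.
  move=> phioo zx.
  have r0phi : z (phi k) - zb (phi k) @[k --> \oo] --> (0 : 'cV[R]_n).
    exact: (cvg_comp _ _ phioo r0).
  split.
    (* [W] is closed: the distance from [x] is at most [|x - z (phi k)| + eps], and this tends to
       [eps]. *)
    have W_lim : qnorm Q (x - z (phi k)) + eps @[k --> \oo] --> eps.
      rewrite -[X in _ --> X]add0r; apply: cvgD; last exact: cvg_cst.
      have -> : 0 = qnorm Q (x - x) by rewrite subrr /qnorm mulmx0 dot0r sqrtr0.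
      by apply: qnorm_cvg; apply: cvgB zx; exact: cvg_cst.
    apply: (cvgr_to_ge W_lim); apply: nearW => k.
    apply: le_trans (qdist_triangle pQ x (z (phi k)) S_neq0) _.
    by rewrite lerD2l; exact: Wz.
  (* As the residuals tend to 0, [zb (phi k)] also tends to [x], while the elements [P (z - zb)] of
     [T] tend to 0. *)
  apply: (T_osc (fun k => zb (phi k)) (fun k => P *m (z (phi k) - zb (phi k)))).
  - by move=> k; exact: (step _).1.
  - rewrite -[x]subr0.
    rewrite (_ : (fun k => _) = (fun k => z (phi k) - (z (phi k) - zb (phi k)))).
      exact: cvgB.
    by apply/funext => k; rewrite subKr.
  - by rewrite -(mulmx0 _ P); apply: cvg_mulmx => //; exact: cvg_cst.
have z_bounded : bounded_fun z.
  have [s Ss] := S_neq0.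
  apply: (qnorm_bounded pQ n_gt0 (s := s) (C := dot (z 0%N - s) (Q *m (z 0%N - s)))).
  by elim=> // k; apply: le_trans; exact: fejer_le.
split.
- by [].
- split=> //.
  + apply: (squeeze_cvgr _ (cvg_cst 0) rnorm0).
    by apply: nearW => k; rewrite sqr_ge0 rdist_le.
  + move=> N; apply/andP; split.
      by apply: le_min_upto => k kN; apply: le_trans (rdist_le k); exact: min_upto_le.
    by apply: le_bound => k; exact: min_upto_le.
  + move=> comon.
    have rnorm_mono : nonincreasing_seq rnorm.
      apply/nonincreasing_seqP => k; rewrite -ler_sqr ?nnegrE ?qnorm_ge0// !rE.
      have [gk zk] := step k; have [gk1 _] := step k.+1; move: gk1; rewrite zk => gk1.
      by apply: (comonotone_step n_gt0 V_sym) => //; apply: comon gk gk1.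
    split=> // N; rewrite rdist_le/=; apply: le_bound => k kN.
    by rewrite ler_sqr ?nnegrE ?qnorm_ge0//; exact: rnorm_mono.
- split=> //.
  + have -> : zb = z \- (fun k => z k - zb k).
      by apply/funext => k /=; rewrite subKr.
    by apply: bounded_funB => //; apply: cvg_seq_bounded; apply/cvg_ex; exists 0.
  + by move=> x /cluster_subseq[phi [phioo zx]]; exact: (lim_pt phi).
  + move=> x /cluster_subseq[phi [phioo zbx]]; apply: (lim_pt phi) => //.
    rewrite -[x]addr0.
    rewrite (_ : (fun k => _) = (fun k => zb (phi k) + (z (phi k) - zb (phi k)))).
      by apply: cvgD => //; exact: (cvg_comp _ _ phioo r0).
    by apply/funext => k; rewrite addrC subrK.
- move=> SE; have [x /cluster_subseq[phi [phioo zx]]] := bounded_cluster z_bounded.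
  (* The assumption on [Sstar] puts the limit point [x] in it, so that the Fejer inequality applies
     with [s = x]. *)
  have xW := lim_pt phi x phioo zx; have Sx : Sstar x by rewrite SE.
  have zlim : z k @[k --> \oo] --> x.
    apply/subr_cvg0; apply: (qnorm_cvg0 pQ) => //.
    apply: (@nonincreasing_subseq_cvg0 _ _ phi).
    - by apply/nonincreasing_seqP => k; exact: fejer_le.
    - by move=> k; exact: (posdef_psd pQ).2.
    - rewrite -(dot0r (0 : 'cV[R]_n)) -[X in dot _ X](mulmx0 _ Q).
      by apply: cvg_quad; apply/subr_cvg0.
  exists x => //; split=> //.
  rewrite -[x]subr0 (_ : zb = (fun k => z k - (z k - zb k))).
    exact: cvgB.
  by apply/funext => k; rewrite subKr.
Qed.
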